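(* Any deterministic LOCAL-model algorithm that finds a maximal independent set in graphs of maximum degree (at most) $\Delta$ requires $\Omega(\min\{\Delta,\log n/\log\log n\})$ rounds. That is, there are constants $c>0$, $n_0$, $\Delta_0$ such that for all integers $n\ge n_0$ and $\Delta\ge\Delta_0$, no deterministic LOCAL-model algorithm with running time $T<c\min\{\Delta,\log n/\log\log n\}$ finds a maximal independent set in every $n$-node graph of maximum degree at most $\Delta$.
   Context: LOCAL model (deterministic): the input is a simple graph with $n$ nodes; nodes are computers, edges are communication links. Each node has a unique identifier from $\{1,2,\dotsc,\mathrm{poly}(n)\}$ (i.e. from $\{1,\dots,n^C\}$ for a fixed sufficiently large constant $C$), numbers its incident edges by ports $1,\dots,\deg$ in an arbitrary order, and knows $n$ and $\Delta$. Computation proceeds in synchronous rounds; in each round each node may send an arbitrary (unbounded) message to each neighbor, receive a message from each neighbor, and perform unbounded local computation. A $T$-round algorithm is equivalently a function assigning to each node an output depending only on its radius-$T$ neighborhood (topology, port numbers, identifiers in it). The algorithm must be correct on every graph of the class, for every assignment of identifiers and port numbers. For maximal independent set, each node must output whether it belongs to the set. Logarithms are to base $2$. *)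

(* Defs.v *)
From HB Require Import structures.
From mathcomp Require Import all_boot all_order all_algebra.
From mathcomp Require Import reals exp.

Set Implicit Arguments.
Unset Strict Implicit.
Unset Printing Implicit Defensive.

Import Order.TTheory GRing.Theory Num.Theory.

Section Graphs.

Variable V : finType.
Implicit Types (e : rel V) (S : {set V}).

Definition simple_graph e : Prop := symmetric e /\ irreflexive e.

Definition degree e (v : V) : nat := #|e v|.

Definition max_degree_le e (Delta : nat) : Prop :=
  forall v, degree e v <= Delta.

Definition independent e S : bool :=
  [forall u in S, forall v in S, ~~ e u v].

Definition maximal_independent_set e S : bool := maxset (independent e) S.

(* [ports v] lists the neighbours of v in the order of v's port numbers: the
   edge {v, u} has at v the port number [port_of ports v u], which lies in
   {1, ..., degree e v}. The two endpoints number the edge independently. *)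
Definition port_numbering e (ports : V -> seq V) : Prop :=
  forall v, uniq (ports v) /\ ports v =i e v.

Definition port_of (ports : V -> seq V) (v u : V) : nat :=
  (index u (ports v)).+1.

Definition id_assignment (N : nat) (ident : V -> nat) : Prop :=
  injective ident /\ forall v, 1 <= ident v <= N.

End Graphs.

(* A deterministic synchronous message-passing algorithm whose nodes output one
   bit. State and message types are arbitrary, as are the functions on them:
   neither message size nor local computation is bounded. *)
Record local_algorithm := LocalAlgorithm {
  state : Type;
  message : Type;
  (* n, Delta, own identifier, own degree *)
  init : nat -> nat -> nat -> nat -> state;
  (* the message sent through the port with the given number *)
  send : state -> nat -> message;
  (* the received messages are listed by increasing port number *)
  receive : state -> seq message -> state;
  output : state -> bool
}.

Section Execution.

Variables (A : local_algorithm) (Delta : nat).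
Variables (V : finType) (e : rel V) (ports : V -> seq V) (ident : V -> nat).

Fixpoint state_after (t : nat) (v : V) : state A :=
  if t is t'.+1 then
    receive (state_after t' v)
      [seq send (state_after t' u) (port_of ports u v) | u <- ports v]
  else init A #|V| Delta (ident v) (degree e v).

Definition output_set (T : nat) : {set V} :=
  [set v | output (state_after T v)].

End Execution.

Definition finds_mis_in (A : local_algorithm) (T n Delta C : nat) : Prop :=
  forall (V : finType) (e : rel V) (ports : V -> seq V) (ident : V -> nat),
    #|V| = n ->
    simple_graph e ->
    max_degree_le e Delta ->
    port_numbering e ports ->
    id_assignment (n ^ C) ident ->
    maximal_independent_set e (output_set A Delta e ports ident T).

Local Open Scope ring_scope.

Definition log2 {R : realType} (x : R) : R := ln x / ln 2.

(* Main.v *)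
(* An algorithm for maximal independent sets, run on the line graph of a fixed
   bipartite host graph restricted to an arbitrary subset F of its edges, finds
   maximal matchings of F.  When the host graph has large girth, round
   elimination applies to such algorithms in spite of the identifiers: a node
   that sees one level less of F can list, for each of its edges, the labels
   that are still possible, and these choices are independent across its edges.
   Each eliminated round swaps the two sides of the host graph and relaxes the
   matching problem by a slack (x, J), sending it to (x + J, J + 1).

   Starting from slack (0, 1) this would only give a bound of order sqrt Delta.
   Therefore the matching is computed after every node of the host graph has
   been split into D nodes of degree at most D.  On the unsplit graph, whose
   degrees are of order D^2, the slack is (0, D) initially and (O(D^2), O(D))
   after D / 10 rounds; counting edges shows that without
   communication this slack does not suffice. *)

From HB Require Import structures.
Require Import Defs.
From mathcomp Require Import all_boot all_order all_algebra.
From mathcomp Require Import reals exp.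
From mathcomp Require Import boolp.
From mathcomp Require Import zify ring lra.

Set Implicit Arguments.
Unset Strict Implicit.
Unset Printing Implicit Defensive.

Import Order.TTheory GRing.Theory Num.Theory.

(** * Round elimination *)

Inductive label := Matched | Other | Wild | Pointer.

Definition label_code (l : label) : bool * bool :=
  match l with
  | Matched => (true, true) | Other => (true, false)
  | Wild => (false, true) | Pointer => (false, false)
  end.

Definition label_decode (c : bool * bool) : label :=
  match c with
  | (true, true) => Matched | (true, false) => Other
  | (false, true) => Wild | (false, false) => Pointer
  end.

Lemma label_codeK : cancel label_code label_decode.
Proof. by case. Qed.

HB.instance Definition _ := Equality.copy label (can_type label_codeK).

Section HostGraph.

Variables (V E : finType) (en : bool -> E -> V) (H : {set E}).

Implicit Types (s : bool) (v : V) (f g : E) (F B : {set E}).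

Definition inc s v : {set E} := [set f in H | en s f == v].

(** Balls are sets of edges, and radius 0 already contains the edges at the node. A node is a vertex
    together with a side, so the side alternates along a walk. *)
Fixpoint ball r s v : {set E} :=
  if r is r'.+1
  then inc s v :|: \bigcup_(f in inc s v) ball r' (~~ s) (en (~~ s) f)
  else inc s v.

Lemma in_inc s v f : (f \in inc s v) = (f \in H) && (en s f == v).
Proof. by rewrite inE. Qed.

Lemma inc_self s f : f \in H -> f \in inc s (en s f).
Proof. by rewrite in_inc eqxx andbT. Qed.

Lemma ballS r s v g :
  reflect (g \in inc s v \/
           exists2 f, f \in inc s v & g \in ball r (~~ s) (en (~~ s) f))
          (g \in ball r.+1 s v).
Proof.
rewrite /= in_setU; apply: (iffP orP) => -[->|h]; [by left| |by left|].
  by right; move/bigcupP: h => [f fi gb]; exists f.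
by right; apply/bigcupP; case: h => f fi gb; exists f.
Qed.

Lemma inc_ball r s v : inc s v \subset ball r s v.
Proof. by case: r => [|r] //=; apply: subsetUl. Qed.

Lemma ball_mono r s v : ball r s v \subset ball r.+1 s v.
Proof.
elim: r s v => [|r IH] s v; first exact: inc_ball.
apply/subsetP => g /ballS[gi|[f fi gb]]; apply/ballS; first by left.
by right; exists f => //; apply: (subsetP (IH _ _)).
Qed.

Lemma ball_mono_le r r' s v : r <= r' -> ball r s v \subset ball r' s v.
Proof.
elim: r' => [|r' IH]; first by rewrite leqn0 => /eqP->.
rewrite leq_eqVlt => /orP[/eqP->//|/IH h].
exact: subset_trans h (ball_mono _ _ _).
Qed.

Lemma ball_side r s f : f \in H ->
  ball r (~~ s) (en (~~ s) f) \subset ball r.+1 s (en s f).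
Proof.
by move=> fH; apply/subsetP => g gb; apply/ballS; right; exists f => //; apply: inc_self.
Qed.

(* Without [Wild], with [x = 0] and [J = 1], this encodes a maximal matching: a
   matched node puts [Matched] on its matching edge and [Other] elsewhere, an
   unmatched node puts [Pointer] everywhere; a passive node accepts one
   [Matched], or no [Matched] provided that it has no [Pointer] either. *)
Definition active x J (lab : E -> label) (A : {set E}) : Prop :=
  [/\ exists2 m, m \in A & lab m = Matched,
      (forall f, f \in A -> lab f <> Pointer) &
      #|[set f in A | lab f \in [:: Matched; Wild]]| <= J]
  \/
  (forall f, f \in A -> lab f \in [:: Wild; Pointer]) /\
  #|[set f in A | lab f == Wild]| <= x.

Definition passive x J (lab : E -> label) (A : {set E}) : Prop :=
  (#|[set f in A | lab f == Matched]| <= J /\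
   exists2 f, f \in A & lab f \in [:: Matched; Wild])
  \/
  #|[set f in A | lab f \in [:: Matched; Pointer]]| <= x.

Lemma eq_passive x J lab lab' (A : {set E}) :
  {in A, lab =1 lab'} -> passive x J lab A -> passive x J lab' A.
Proof.
move=> e; have eqs (P : pred label) :
    [set f in A | P (lab f)] = [set f in A | P (lab' f)].
  by apply/setP => f; rewrite !inE; case fA: (f \in A) => //=; rewrite e.
rewrite /passive (eqs (pred1 Matched)) (eqs (mem [:: Matched; Pointer])).
by case=> [[h [f fA fl]]|]; [left; split=> //; exists f => //; rewrite -e | right].
Qed.

(* [s] is the side of the active nodes, which write the labels of their edges
   and see the input set [F] of edges up to radius [r]. *)
Definition solves s r x J (out : {set E} -> E -> label) : Prop :=
  [/\ (forall F F' f, f \in H ->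
         F :&: ball r s (en s f) = F' :&: ball r s (en s f) ->
         out F f = out F' f),
      (forall F v, active x J (out F) (F :&: inc s v)) &
      (forall F v, passive x J (out F) (F :&: inc (~~ s) v))].

Definition branches_disjoint r : Prop :=
  forall s v f f', f \in inc s v -> f' \in inc s v -> f != f' ->
  ball r.+1 (~~ s) (en (~~ s) f) :&: ball r.+1 (~~ s) (en (~~ s) f')
    \subset ball r s v.

(** * One round of elimination *)

Section Step.

Variables (s : bool) (r x J : nat) (out : {set E} -> E -> label).
Hypothesis out_solves : solves s r.+1 x J out.
Hypothesis disj : branches_disjoint r.

Definition possible B f l : bool :=
  [exists F' : {set E},
     (F' :&: ball r (~~ s) (en (~~ s) f) == B) && (out F' f == l)].

Lemma possible_out F f : possible (F :&: ball r (~~ s) (en (~~ s) f)) f (out F f).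
Proof. by apply/existsP; exists F; rewrite !eqxx. Qed.

(* The branches behind distinct edges at [u] are disjoint outside the ball of
   [u], so possible labels of its edges can be realised simultaneously. *)
Lemma possible_passive F u sel :
  (forall f, f \in F :&: inc (~~ s) u ->
     possible (F :&: ball r (~~ s) u) f (sel f)) ->
  passive x J sel (F :&: inc (~~ s) u).
Proof.
case: out_solves => loc _ pas; set A := F :&: inc (~~ s) u => hsel.
have /fin_all_exists[W hW] : forall f, exists F' : {set E}, f \in A ->
    (F' :&: ball r (~~ s) u = F :&: ball r (~~ s) u) /\ out F' f = sel f.
  move=> f; case fA: (f \in A); last by exists set0.
  have /existsP[F' /andP[/eqP h1 /eqP h2]] := hsel f fA.
  exists F' => _; split => //; move: fA h1.
  by rewrite inE in_inc => /and3P[_ _ /eqP->].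
(* [G] follows [F] near [u] and, behind each edge [f], an input [W f] that realises [sel f]. *)
pose G := [set g | if g \in ball r (~~ s) u then g \in F else
  [exists f in A, (g \in ball r.+1 s (en s f)) && (g \in W f)]].
have GA : G :&: inc (~~ s) u = A.
  apply/setP => g; rewrite !inE; case gH: (g \in H) => /=; last by rewrite !andbF.
  case gu: (en (~~ s) g == u); rewrite ?andbF //= !andbT.
  by rewrite (subsetP (inc_ball _ _ _)) // in_inc gH.
have Gb f : f \in A -> G :&: ball r.+1 s (en s f) = W f :&: ball r.+1 s (en s f).
  move=> fA; apply/setP => g; rewrite inE [RHS]inE.
  case gb: (g \in ball r.+1 s _); rewrite ?andbF ?andbT // inE.
  case gu: (g \in ball r (~~ s) u).
    by have [/setP/(_ g)] := hW f fA; rewrite !inE gu !andbT.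
  apply/existsP/idP => [[f' /and3P[f'A gb' gW]]|gW]; last first.
    by exists f; rewrite fA gb.
  have [->//|ff'] := eqVneq f f'.
  have fi : f \in inc (~~ s) u by move: fA; rewrite inE => /andP[].
  have f'i : f' \in inc (~~ s) u by move: f'A; rewrite inE => /andP[].
  have := subsetP (disj fi f'i ff') g.
  by rewrite negbK in_setI gb gb' gu => /(_ isT).
have := pas G u; rewrite GA; apply: eq_passive => f fA.
have [_ <-] := hW f fA; apply: loc; last exact: Gb.
by move: fA; rewrite inE in_inc => /and3P[].
Qed.

Definition stepA B u := B :&: inc (~~ s) u.
Definition stepM B u := [set f in stepA B u | possible B f Matched].
Definition stepP B u := [set f in stepA B u | possible B f Pointer].
Definition stepGood B u f :=
  [&& f \in stepA B u, ~~ possible B f Other & ~~ possible B f Pointer].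

(* The labels [Other] and [Pointer] exchange their meaning at each step: here
   [Other] is offered on every edge that the node does not match itself. *)
Definition step_label B u f : label :=
  if #|stepM B u :|: stepP B u| <= x + J then
    if f \in stepM B u :|: stepP B u then Wild else Pointer
  else if [pick g | stepGood B u g] is Some g then
    if f == g then Matched else if f \in stepM B u then Wild else Other
  else Other.

Definition step_out F f : label :=
  let u := en (~~ s) f in step_label (F :&: ball r (~~ s) u) u f.

Lemma stepA_ball F u : stepA (F :&: ball r (~~ s) u) u = F :&: inc (~~ s) u.
Proof. by rewrite /stepA -setIA (setIidPr (inc_ball _ _ _)). Qed.

(** Choosing [Matched], else [Pointer], wherever possible gives more than [x] such labels, so
    [passive] bounds the edges admitting [Matched] by [J]. Hence more than [x] edges admit
    [Pointer]; choosing [Pointer], else [Other], then forces an edge that admits neither. *)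
Lemma step_good_exists F u (B := F :&: ball r (~~ s) u) :
  x + J < #|stepM B u :|: stepP B u| ->
  #|stepM B u| <= J /\ exists g, stepGood B u g.
Proof.
move=> big; have BA : stepA B u = F :&: inc (~~ s) u by exact: stepA_ball.
have some f : exists l, f \in stepA B u -> possible B f l.
  exists (out F f); rewrite BA inE in_inc => /and3P[_ _ /eqP fu].
  by rewrite /B -fu; apply: possible_out.
have {some}/fin_all_exists[lab hlab] := some.
have leM : #|stepM B u| <= J.
  pose sel f := if possible B f Matched then Matched else
                if possible B f Pointer then Pointer else lab f.
  have selP f : f \in F :&: inc (~~ s) u -> possible B f (sel f).
    rewrite -BA => fA; rewrite /sel; case: ifP => // _; case: ifP => // _.
    exact: hlab.
  have [[le _]|le] := possible_passive selP.
    apply: leq_trans le; apply/subset_leq_card/subsetP => f.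
    by rewrite inE -BA inE /sel => /andP[-> ->].
  suff : x + J < x by lia.
  apply: leq_trans big (leq_trans _ le); apply/subset_leq_card/subsetP => f.
  have inM : (f \in stepM B u) = (f \in stepA B u) && possible B f Matched.
    by rewrite inE.
  have inP : (f \in stepP B u) = (f \in stepA B u) && possible B f Pointer.
    by rewrite inE.
  rewrite in_setU inM inP -andb_orr -BA [in X in _ -> X]inE /sel => /andP[-> /=].
  by case: (possible B f Matched) => //= ->.
split => //; apply/existsP/contraT => /existsPn none.
have ltP : x < #|stepP B u|.
  have := (leq_card_setU (stepM B u) (stepP B u)).1; lia.
pose sel f := if possible B f Pointer then Pointer else
              if possible B f Other then Other else lab f.
have selP f : f \in F :&: inc (~~ s) u -> possible B f (sel f).
  rewrite -BA => fA; rewrite /sel; case: ifP => // _; case: ifP => // _.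
  exact: hlab.
have [[_ [f fA]]|le] := possible_passive selP.
  move: fA (none f); rewrite -BA /stepGood /sel => -> /=.
  by case: (possible B f Pointer) => //=; case: (possible B f Other).
suff : #|stepP B u| <= x by lia.
apply: leq_trans le; apply/subset_leq_card/subsetP => f.
by rewrite inE -BA inE /sel => /andP[-> ->].
Qed.

Lemma step_active F u : active (x + J) J.+1 (step_out F) (F :&: inc (~~ s) u).
Proof.
set B := F :&: ball r (~~ s) u.
have BA : stepA B u = F :&: inc (~~ s) u by exact: stepA_ball.
have outE f : f \in stepA B u -> step_out F f = step_label B u f.
  by rewrite inE in_inc /step_out /= => /and3P[_ _ /eqP->].
rewrite -BA; case: (leqP #|stepM B u :|: stepP B u| (x + J)) => [small|big].
  right; split => [f fA|].
    by rewrite outE // /step_label small; case: ifP.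
  apply: leq_trans (small); apply/subset_leq_card/subsetP => f.
  rewrite inE => /andP[fA]; rewrite outE // /step_label small.
  by case: ifP.
have [leM [g0 good0]] := step_good_exists big.
left; move: outE; rewrite /step_label leqNgt big /=.
case: pickP => [g gg outE|/(_ g0)]; last by rewrite good0.
have gA : g \in stepA B u by case/and3P: gg.
split; first by exists g => //; rewrite outE // eqxx.
- by move=> f fA; rewrite outE //; case: ifP => // _; case: ifP.
- apply: (@leq_trans #|g |: stepM B u|); last first.
    by rewrite cardsU1 -add1n leq_add ?leq_b1.
  apply/subset_leq_card/subsetP => f; rewrite inE => /andP[fA].
  rewrite outE // in_setU1; case: (f == g) => //=.
  by case: (f \in stepM B u).
Qed.

(** The old label is itself possible in the new view, which restricts the new label on the same
    edge; this is all that the old active nodes need when they turn passive. *)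
Lemma step_compatible F f : f \in F -> f \in H ->
  [/\ out F f = Matched -> step_out F f \in [:: Matched; Wild],
      out F f = Other -> step_out F f <> Matched &
      out F f = Pointer -> step_out F f \in [:: Other; Wild]].
Proof.
move=> fF fH; have := possible_out F f.
rewrite /step_out /=; set u := en (~~ s) f; set B := F :&: _.
have fA : f \in stepA B u by rewrite stepA_ball inE fF inc_self.
have fM : f \in stepM B u = possible B f Matched by rewrite inE fA.
have fP : f \in stepP B u = possible B f Pointer by rewrite inE fA.
have [small|big] := leqP #|stepM B u :|: stepP B u| (x + J).
  rewrite /step_label small in_setU fM fP.
  by case: (out F f) => pos; split => // _; rewrite ?pos ?orbT //; case: ifP.
have [_ [g0 good0]] := step_good_exists big.
rewrite /step_label leqNgt big /=; case: pickP => [g|/(_ g0)]; last first.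
  by rewrite good0.
case/and3P => _ nO nP pos.
split => outE; rewrite outE in pos.
- by case: ifP => // _; rewrite fM pos.
- case: eqP => [fg|_]; first by rewrite -fg pos in nO.
  by case: ifP.
- case: eqP => [fg|_]; first by rewrite -fg pos in nP.
  by case: ifP.
Qed.

(** New [Matched] arises only from old [Matched] or [Wild]; where all old labels are [Wild] or
    [Pointer], new [Matched] or [Pointer] arises only from [Wild]. So the old bounds carry over. *)
Lemma step_passive F v : passive (x + J) J.+1 (step_out F) (F :&: inc s v).
Proof.
case: out_solves => _ act _.
have comp f : f \in F :&: inc s v ->
  [/\ out F f = Matched -> step_out F f \in [:: Matched; Wild],
      out F f = Other -> step_out F f <> Matched &
      out F f = Pointer -> step_out F f \in [:: Other; Wild]].
  by rewrite in_setI in_inc => /and3P[fF fH _]; apply: step_compatible.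
have [[[m mA mM] noP le]|[XP le]] := act F v.
  left; split; last first.
    by exists m => //; have [+ _ _] := comp m mA; apply.
  apply: leq_trans (leqW le); apply/subset_leq_card/subsetP => f.
  rewrite inE => /andP[fA /eqP sM]; rewrite inE fA /=.
  have := noP f fA; have [_ hO hP] := comp f fA.
  by case E1: (out F f) => //; have := hO E1.
right; apply: leq_trans (leq_addr _ _); apply: leq_trans le.
apply/subset_leq_card/subsetP => f.
rewrite inE => /andP[fA sM]; rewrite inE fA /=.
have := XP f fA; have [_ _ hP] := comp f fA.
by case E1: (out F f) => //; move: sM (hP E1); case: (step_out F f).
Qed.

Lemma step_solves : solves (~~ s) r (x + J) J.+1 step_out.
Proof.
split => [F F' f fH e|F v|F v]; last by rewrite negbK; apply: step_passive.
- by rewrite /step_out /= e.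
- exact: step_active.
Qed.

End Step.

(** Each round adds the current second slack to the first, and that never exceeds [J + r]. *)
Lemma iterate_step s r x J out :
  (forall i, i < r -> branches_disjoint i) -> solves s r x J out ->
  exists s' x' out', x' <= x + r * (J + r) /\ solves s' 0 x' (J + r) out'.
Proof.
elim: r s x J out => [|r IH] s x J out dis sol.
  by exists s, x, out; rewrite !addn0.
have dis' i (ir : i < r) : branches_disjoint i by apply: dis; apply: ltnW.
have [s' [x' [out' [le sol']]]] := IH _ _ _ _ dis' (step_solves sol (dis r (ltnSn r))).
exists s', x', out'; rewrite -addSnnS; split => //; nia.
Qed.

(** * Counting for algorithms without communication *)

Lemma card_inc_sum s (S : {set E}) : S \subset H ->
  \sum_v #|S :&: inc s v| = #|S|.
Proof.
move=> SH; rewrite -sum1_card (partition_big (en s) predT) //=.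
apply: eq_bigr => v _; rewrite -sum1_card; apply: eq_bigl => f.
rewrite !inE; case fS: (f \in S) => //=.
by rewrite (subsetP SH) // fS.
Qed.

(* An edge may receive [Matched] from few positions and [Pointer] from few
   positions seen from the passive side, yet every active node must give one of
   the two to almost all of its edges. *)
Lemma zero_round_card s x J out :
  (forall v, {in inc (~~ s) v &, injective (en s)}) ->
  solves s 0 x J out -> #|H| <= #|V| * (J + 3 * x).
Proof.
move=> inj [loc act pas].
pose can l := [set f in H | [exists F : {set E}, (f \in F) && (out F f == l)]].
have canH l : can l \subset H by apply/subsetP => f; rewrite inE => /andP[].
(* Edges at [u] have distinct active ends by [inj], so the inputs that give each of them [l] combine
   into one. *)
have real l u : passive x J (fun=> l) (can l :&: inc (~~ s) u).
  set A := can l :&: _.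
  have /fin_all_exists[W hW] : forall f, exists F : {set E},
      f \in A -> f \in F /\ out F f = l.
    move=> f; case fA: (f \in A); last by exists set0.
    move: fA; rewrite !inE => /andP[/andP[_ /existsP[F /andP[fF /eqP h]]] _].
    by exists F.
  pose G := [set g | [exists f in A, (en s g == en s f) && (g \in W f)]].
  have GA : G :&: inc (~~ s) u = A.
    apply/setP => g; rewrite in_setI inE; apply/andP/idP => [[]|gA]; last first.
      split; last by move: gA; rewrite inE => /andP[].
      by apply/existsP; exists g; rewrite gA eqxx; have [] := hW g gA.
    move=> /existsP[f /and3P[fA /eqP e _]] gi.
    suff -> : g = f by [].
    by apply: inj e; first exact: gi; move: fA; rewrite inE => /andP[].
  have := pas G u; rewrite GA; apply: eq_passive => f fA.
  have [fF <-] := hW f fA; apply: loc.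
    by apply: (subsetP (canH l)); move: fA; rewrite inE => /andP[].
  apply/setP => g; rewrite !inE /=; case gH: (g \in H) => /=; last by rewrite !andbF.
  case: eqP => e; rewrite ?andbF ?andbT //.
  apply/existsP/idP => [[f' /and3P[f'A /eqP e' gW]]|gW]; last first.
    by exists f; rewrite fA e eqxx.
  suff -> : f = f' by [].
  apply: inj; last by rewrite -e.
    by move: fA; rewrite inE => /andP[_]; apply.
  by move: f'A; rewrite inE => /andP[].
have leM u : #|can Matched :&: inc (~~ s) u| <= J + x.
  have sub (p : bool) : p ->
      [set f in can Matched :&: inc (~~ s) u | p] = can Matched :&: inc (~~ s) u.
    by move=> h; apply/setP => f; rewrite inE h andbT.
  have := real Matched u; rewrite /passive !sub //.
  by case=> [[]|]; lia.
have leP u : #|can Pointer :&: inc (~~ s) u| <= x.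
  have [[_ [f _]]|] := real Pointer u; first by [].
  by congr (_ <= _); apply: eq_card => f; rewrite inE andbT.
have leA v : #|H :&: inc s v| <=
    #|can Matched :&: inc s v| + (#|can Pointer :&: inc s v| + x).
  (* No edge of this input can be [Matched], so every active node is left with [Pointer] and at most
     [x] edges [Wild]. *)
  set F := (H :\: can Matched).
  have cov : H :&: inc s v \subset
     (can Matched :&: inc s v) :|: (F :&: inc s v).
    apply/subsetP => f; rewrite !inE.
    by case: (f \in H); case: [exists _, _]; case: (_ == v).
  apply: leq_trans (subset_leq_card cov) (leq_trans (leq_card_setU _ _) _).
  rewrite leq_add2l.
  have [[[m mA mM] _ _]|[XP le]] := act F v.
    have mF : m \in F by move: mA; rewrite inE => /andP[].
    move: (mF); rewrite !inE => /andP[+ mH].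
    by rewrite mH /= => /existsP[]; exists F; rewrite mF mM eqxx.
  apply: (@leq_trans #|(can Pointer :&: inc s v) :|:
      [set f in F :&: inc s v | out F f == Wild]|); last first.
    by apply: leq_trans (leq_card_setU _ _) _; rewrite leq_add2l.
  apply/subset_leq_card/subsetP => f fA; have := XP f fA.
  rewrite in_setU orbC 2!inE fA; case E1: (out F f) => //= _.
  move: (fA); rewrite !inE => /andP[/andP[_ fH] /andP[_ ->]].
  rewrite fH /= andbT; apply/existsP; exists F.
  by rewrite E1 eqxx andbT; move: fA; rewrite inE => /andP[].
rewrite -(@card_inc_sum s H) //.
apply: leq_trans (leq_sum _ (fun v _ => leA v)) _.
rewrite !big_split /= !card_inc_sum //.
rewrite -(card_inc_sum (~~ s) (canH Matched)) -(card_inc_sum (~~ s) (canH Pointer)).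
have sumM := leq_sum (index_enum V) (fun v (_ : true) => leM v).
have sumP := leq_sum (index_enum V) (fun v (_ : true) => leP v).
apply: leq_trans (leq_add sumM (leq_add sumP (leqnn _))) _.
rewrite !sum_nat_const -!mulnDr leq_mul //; lia.
Qed.

End HostGraph.

(** * Dense host graphs of large girth *)

Lemma leq_card_bigcup (I T : finType) (P : pred I) (A : I -> {set T}) :
  #|\bigcup_(i | P i) A i| <= \sum_(i | P i) #|A i|.
Proof.
elim/big_rec2: _ => [|i n B _ le]; first by rewrite cards0.
by apply: leq_trans (leq_card_setU _ _) _; rewrite leq_add2l.
Qed.

Lemma mem_split_rcons (T : eqType) (z : T) (p : seq T) :
  z \in p -> exists p1 p2, p = rcons p1 z ++ p2.
Proof. by case/splitPr => p1 p2; exists p1, p2; rewrite cat_rcons. Qed.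

Lemma neq_negb (a b : bool) : a != b -> a = ~~ b.
Proof. by case: a; case: b. Qed.

Section Girth.

Variables (V E : finType) (en : bool -> E -> V).

Implicit Types (H : {set E}) (s d : bool) (v : V) (f g h : E).
Implicit Types (x y : bool * E) (p q : seq (bool * E)).

(* The pair [(s, f)] stands for the edge [f] directed towards its end on side
   [s]; paths of this relation are walks that never turn back along an edge. *)
Definition dart_step H x y :=
  [&& y.1 == ~~ x.1, y.2 \in H, y.2 != x.2 & en x.1 y.2 == en x.1 x.2].

(** A return to an edge without backtracking, in either direction, always contains a cycle, so this
    says that the girth exceeds [k]. *)
Definition girth_gt H k : Prop :=
  forall x p, path (dart_step H) x p -> 0 < size p <= k ->
  (last x p).2 <> x.2.

Definition flip x := (~~ x.1, x.2).

Lemma dart_step_flip H x y :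
  x.2 \in H -> dart_step H x y -> dart_step H (flip y) (flip x).
Proof.
case: x y => [s f] [s' f'] /= fH /and4P[/= /eqP-> _ nff /eqP e].
by apply/and4P; split => //=; rewrite ?negbK ?e // eq_sym.
Qed.

Lemma path_flip H x p : x.2 \in H -> path (dart_step H) x p ->
  exists p', [/\ path (dart_step H) (flip (last x p)) p',
                 last (flip (last x p)) p' = flip x & size p' = size p].
Proof.
elim: p x => [|y p IH] x xH /=; first by exists [::].
case/andP => xy /IH[|p' [pp' lp' sp']]; first by case/and4P: xy.
exists (rcons p' (flip x)); rewrite rcons_path pp' lp' last_rcons size_rcons sp'.
by split => //=; apply: dart_step_flip.
Qed.

(** A walk to [h] either starts through [f], which uses up a step, or leaves [f] by another edge,
    and any later backtracking can be cut out. *)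
Lemma ball_dart_path H r s f h : f \in H -> h \in ball en H r s (en s f) ->
  h \in ball en H r.-1 (~~ s) (en (~~ s) f) \/
  exists2 p, path (dart_step H) (s, f) p &
             size p <= r.+1 /\ (last (s, f) p).2 = h.
Proof.
have base r' s' f' h' : h' \in inc en H s' (en s' f') ->
    exists2 p, path (dart_step H) (s', f') p &
               size p <= r'.+1 /\ (last (s', f') p).2 = h'.
  rewrite in_inc => /andP[hH e]; have [->|ne] := eqVneq h' f'.
    by exists [::].
  by exists [:: (~~ s', h')] => //=; rewrite /dart_step /= eqxx hH ne e.
elim: r s f => [|r IH] s f fH; first by move=> hi; right; apply: base.
case/ballS => [hi|[f' f'i hb]]; first by right; apply: base.
have [ff'|ne] := eqVneq f' f; first by left; rewrite -ff'.
move: f'i; rewrite in_inc => /andP[f'H /eqP e].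
case: (IH _ _ f'H hb) => [|[p pp [sp lp]]].
  rewrite negbK e => /(subsetP (ball_mono_le _ _ _ _ (leq_pred r))).
  case/IH => // [hb'|[p pp [sp lp]]]; last first.
    by right; exists p => //; split => //; apply: leqW.
  by left; apply: (subsetP (ball_mono_le _ _ _ _ (leq_pred r))).
right; exists ((~~ s, f') :: p) => //=.
by rewrite pp andbT /dart_step /= eqxx f'H ne e eqxx.
Qed.

(** Outside the ball of [v], reversing the walk from [f] to [h], crossing [v] and walking from [f']
    to [h] would return to the edge [h] within (r + 2) + 1 + (r + 2) steps. *)
Lemma girth_branches_disjoint H r :
  girth_gt H (r + r + 5) -> branches_disjoint en H r.
Proof.
move=> gt s v f f'; rewrite !in_inc => /andP[fH /eqP ev] /andP[f'H /eqP ev'] ne.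
apply/subsetP => h; rewrite inE => /andP[hb hb'].
case: (ball_dart_path fH hb) => [|[p pp [sp lp]]]; first by rewrite negbK ev.
case: (ball_dart_path f'H hb') => [|[p' pp' [sp' lp']]]; first by rewrite negbK ev'.
have [q [pq lq sq]] := path_flip (x := (~~ s, f)) fH pp.
exfalso; apply: (gt (flip (last (~~ s, f) p)) (q ++ (~~ s, f') :: p')).
- rewrite cat_path pq lq /= pp' andbT.
  by apply/and4P; split => //=; rewrite ?negbK ?ev ?ev' // eq_sym.
- by rewrite size_cat sq /=; lia.
- by rewrite last_cat lq /= lp' lp.
Qed.

Lemma girth_inc_inj H s v :
  girth_gt H 2 -> {in inc en H (~~ s) v &, injective (en s)}.
Proof.
move=> gt f f'; rewrite !in_inc => /andP[fH /eqP ev] /andP[f'H /eqP ev'] e.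
apply/eqP/contraT => ne.
exfalso; apply: (gt (s, f) [:: (~~ s, f'); (s, f)]) => //=.
by rewrite /dart_step /= !eqxx negbK fH f'H ne eq_sym ne e ev ev' !eqxx.
Qed.

Lemma ball_adjacent H r s v h h' d : h \in ball en H r s v -> h' \in H ->
  en d h' = en d h -> h' \in ball en H r.+1 s v.
Proof.
move=> hb h'H; elim: r s v hb => [|r IH] s v hb e.
  move: hb; rewrite in_inc => /andP[hH /eqP hv].
  have [ds|ds] := eqVneq d s.
    by apply/ballS; left; rewrite in_inc h'H -ds e ds hv eqxx.
  have {ds} ds := neq_negb ds.
  apply/ballS; right; exists h; first by rewrite in_inc hH hv eqxx.
  by rewrite /= in_inc h'H -ds e eqxx.
case/ballS: hb => [hi|[f fi hb]].
  have [ds|ds] := eqVneq d s.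
    move: hi; rewrite in_inc => /andP[_ /eqP hv].
    by apply/ballS; left; rewrite in_inc h'H -ds e ds hv eqxx.
  have {ds} ds := neq_negb ds.
  apply/ballS; right; exists h => //.
  by apply: (subsetP (inc_ball _ _ _ _ _)); rewrite in_inc h'H -ds e eqxx.
by apply/ballS; right; exists f => //; apply: IH.
Qed.

Lemma ball_path H r s v x p : x.2 \in ball en H r s v ->
  path (dart_step H) x p -> (last x p).2 \in ball en H (r + size p) s v.
Proof.
elim: p r x => [|y p IH] r x xb /=; first by rewrite addn0.
case/andP => /and4P[_ yH _ /eqP e] pp; rewrite addnS -addSn; apply: IH pp.
exact: ball_adjacent e.
Qed.

Lemma ball_sym H r s v h d : h \in ball en H r s v ->
  exists2 f, f \in inc en H s v & f \in ball en H r.+1 d (en d h).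
Proof.
elim: r s v => [|r IH] s v hb.
  exists h => //; apply: (subsetP (inc_ball _ _ _ _ _)); apply: inc_self.
  by move: hb; rewrite in_inc => /andP[].
case/ballS: hb => [hi|[f fi hb]].
  exists h => //; apply: (subsetP (inc_ball _ _ _ _ _)); apply: inc_self.
  by move: hi; rewrite in_inc => /andP[].
have [f' f'i f'b] := IH _ _ hb.
exists f => //; apply: (ball_adjacent (d := ~~ s)) f'b _ _.
  by move: fi; rewrite in_inc => /andP[].
by move: f'i; rewrite in_inc => /andP[_ /eqP].
Qed.

(** A short walk between the two ends of [f], which [f] would close to a short cycle; an edge of [H]
    is linked through itself. *)
Definition linked H k s f :=
  exists2 h, h \in ball en H k s (en s f) & en (~~ s) h = en (~~ s) f.

Lemma linked_sym H k s f : linked H k (~~ s) f -> linked H k.+1 s f.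
Proof.
case=> h /(ball_sym s)[f' f'i f'b]; rewrite negbK => e; exists f'.
  by rewrite -e.
by move: f'i; rewrite in_inc => /andP[_ /eqP].
Qed.

Lemma path_without H f x p : f \notin map snd p ->
  path (dart_step (f |: H)) x p -> path (dart_step H) x p.
Proof.
elim: p x => [|y p IH] x //=; rewrite inE negb_or => /andP[ne nf].
case/andP => /and4P[h1 h2 h3 h4] /IH->//; rewrite andbT.
move: h2; rewrite in_setU1 eq_sym (negPf ne) /= => h2.
exact/and4P.
Qed.

(* A shortest closed walk through the new edge passes it once, so its remainder
   links the two ends of that edge. *)
Lemma girth_add H k f :
  girth_gt H k -> ~ linked H k.+1 true f -> girth_gt (f |: H) k.
Proof.
move=> gt nl.
have nlk s : ~ linked H k s f.
  case: s => [[h hb e]|l]; last by apply: nl; apply: linked_sym.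
  by apply: nl; exists h => //; apply: (subsetP (ball_mono _ _ _ _ _)).
move=> x p; have [m] := ubnP (size p).
elim: m x p => // m IH x p; rewrite ltnS => sm.
have [xf|xf] := eqVneq x.2 f.
  case/lastP: p sm => [|p z] // sm pp; rewrite last_rcons size_rcons => sk zx.
  have /= := pp; rewrite rcons_path => /andP[pp0 /and4P[z1 _ z3 /eqP z4]].
  have [/mapP[d dp fd]|np] := boolP (f \in map snd p).
    have [p1 [p2 e]] := mem_split_rcons dp.
    apply: (IH x (rcons p1 d)).
    - by move: sm; rewrite e size_rcons !size_cat size_rcons; lia.
    - by move: pp0; rewrite e cat_path => /andP[].
    - by move: sk; rewrite e !size_cat size_rcons; lia.
    - by rewrite last_rcons -fd.
  have := path_without np pp0; move: z1 z3 z4 sk.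
  case: p {pp pp0 np sm} => [|y q] /=; first by rewrite zx eqxx.
  set w := last y q => z1 z3 z4 sk /andP[/and4P[/eqP y1 y2 y3 /eqP y4] pq].
  have yb : y.2 \in ball en H 0 x.1 (en x.1 f).
    by rewrite in_inc y2 y4 xf eqxx.
  have wb := ball_path yb pq; rewrite -/w add0n in wb.
  (* Either the walk leaves [f] at one end and returns at the other, which links the ends, or it
     returns at the same end, and the part from [y] to [w] closes up within [H]. *)
  have [ws|ws] := eqVneq w.1 x.1; last first.
    have {ws} ws := neq_negb ws.
    apply: (nlk x.1); exists w.2.
      by apply: (subsetP (ball_mono_le _ _ _ _ _)) wb; lia.
    by rewrite -ws -z4 zx xf.
  have [yw|yw] := eqVneq y.2 w.2.
    apply: (gt y q pq); last by [].
    move: ws; rewrite /w; case: (q) sk => [|? ?] /= sk; last by move=> _; lia.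
    by rewrite y1; case: x.1.
  apply: (gt y (rcons q (~~ x.1, y.2))).
  - rewrite rcons_path pq /dart_step -/w /= ws eqxx y2 yw /=.
    by rewrite -ws -z4 ws zx y4.
  - by rewrite size_rcons; lia.
  - by rewrite last_rcons.
move=> pp sk lx.
have [/mapP[d dp fd]|np] := boolP (f \in map snd p); last first.
  exact: gt (path_without np pp) sk lx.
have [p1 [p2 e]] := mem_split_rcons dp.
move: (pp); rewrite e cat_path rcons_path last_rcons.
case/andP => /andP[pp1 xd] pp2.
have np1 : f \notin map snd p1.
  apply/negP => /mapP[d' d'p fd']; have [a [b e']] := mem_split_rcons d'p.
  apply: (IH d' (rcons b d)).
  - by move: sm; rewrite e e' size_rcons !size_cat !size_rcons size_cat size_rcons; lia.
  - move: pp1 xd; rewrite e' cat_path last_cat last_rcons => /andP[_ pb] xd'.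
    by rewrite rcons_path pb.
  - by move: sk; rewrite e e' size_rcons !size_cat !size_rcons size_cat size_rcons; lia.
  - by rewrite last_rcons -fd -fd'.
have np2 : f \notin map snd p2.
  apply/negP => /mapP[d' d'p fd']; have [a [b e']] := mem_split_rcons d'p.
  apply: (IH d (rcons a d')).
  - by move: sm; rewrite e e' size_rcons !size_cat !size_rcons; lia.
  - by move: pp2; rewrite e' cat_path => /andP[].
  - by move: sk; rewrite e e' size_rcons !size_cat !size_rcons; lia.
  - by rewrite last_rcons -fd -fd'.
have := path_without np2 pp2; have pp1H := path_without np1 pp1.
move: lx sk; rewrite e last_cat last_rcons size_cat size_rcons.
case: p2 {e pp2 np2} => [|y q] /=; first by rewrite -fd => h; rewrite h eqxx in xf.
move=> lx sk /andP[/and4P[_ yH _ /eqP ey] pq].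
(* The walk may come back to its first edge reversed, so [p2] and [p1] need not concatenate;
   [ball_path] depends on the edge alone and chains them. *)
have yb : y.2 \in ball en H 0 d.1 (en d.1 f) by rewrite in_inc yH ey -fd eqxx.
have := ball_path yb pq; rewrite lx => /ball_path /(_ pp1H) xb.
case/and4P: xd => /eqP d1 _ _ /eqP ed.
apply: (nlk d.1); exists (last x p1).2.
  by apply: (subsetP (ball_mono_le _ _ _ _ _)) xb; lia.
by rewrite d1 negbK -ed -fd.
Qed.

Lemma card_ball_lt H (d : nat) r s v : (forall s v, #|inc en H s v| <= d) ->
  #|ball en H r s v| < d.+1 ^ r.+1.
Proof.
move=> deg; elim: r s v => [|r IH] s v /=; first by rewrite expn1 ltnS.
have lesum : #|\bigcup_(f in inc en H s v) ball en H r (~~ s) (en (~~ s) f)|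
    <= d * (d.+1 ^ r.+1).-1.
  apply: (@leq_trans (\sum_(f in inc en H s v) (d.+1 ^ r.+1).-1)); last first.
    by rewrite sum_nat_const leq_mul2r deg orbT.
  apply: leq_trans (leq_card_bigcup _ _) _; apply: leq_sum => f _.
  by rewrite -ltnS prednK ?expn_gt0.
apply: leq_ltn_trans (leq_card_setU _ _) _.
apply: leq_ltn_trans (leq_add (deg s v) lesum) _.
rewrite [X in _ < X]expnS; have : 0 < d.+1 ^ r.+1 by rewrite expn_gt0.
move: (d.+1 ^ r.+1) => a; nia.
Qed.

End Girth.

(** * Maximal host graphs of bounded degree *)

Section DenseHost.

Variables (V E : finType) (D k : nat) (ven : bool -> E -> V * 'I_D).
Hypothesis ven_surj : forall w b, exists f, ven true f = w /\ ven false f = b.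

(** Degrees are bounded at the split nodes [ven s f], while girth is measured at the unsplit ends
    [en s f]; the second component of [ven s f] names the copy. *)
Let en s f := (ven s f).1.

Definition degree_le (H : {set E}) : Prop :=
  forall s w, #|inc ven H s w| <= D.

Lemma card_inc_fst H s v : degree_le H -> #|inc en H s v| <= D * D.
Proof.
move=> deg; have -> : inc en H s v = \bigcup_i inc ven H s (v, i).
  apply/setP => f; rewrite in_inc; apply/andP/bigcupP => [[fH /eqP e]|[i _]].
    by exists (ven s f).2 => //; rewrite in_inc fH -e -surjective_pairing eqxx.
  by rewrite in_inc /en => /andP[-> /eqP->].
apply: (@leq_trans (\sum_(i < D) D)); last by rewrite sum_nat_const card_ord.
apply: leq_trans (leq_card_bigcup _ _) _.
by apply: leq_sum => i _; apply: deg.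
Qed.

(* In a maximal host graph, the nodes of the passive side that still have spare
   degree all lie close to any node of the active side with spare degree. *)
Lemma dense_host : exists H : {set E},
  [/\ degree_le H, girth_gt en H k &
      D * (#|V| * D) <= #|H| + D * (D * (D * D).+1 ^ k.+2)].
Proof.
pose good H : bool := `[< degree_le H /\ girth_gt en H k >].
have good0 : exists H, good H.
  exists set0; apply/asboolP; split => [s w|x [|y p]] //=.
    by rewrite (_ : inc _ _ _ _ = set0) ?cards0 //; apply/setP => f; rewrite !inE.
  by rewrite /dart_step inE andbF.
have [H /maxsetP[/asboolP[deg gt] Hmax]] := ex_maxset good0.
exists H; split => //.
have cardH s : #|H| = \sum_w #|inc ven H s w|.
  rewrite -(@card_inc_sum _ _ ven H s H) //; apply: eq_bigr => w _.
  by apply: eq_card => f; rewrite !inE; case: (f \in H).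
have cardV : #|{: V * 'I_D}| = #|V| * D by rewrite card_prod card_ord.
have [full|] := boolP [forall w, D <= #|inc ven H true w|].
  apply: leq_trans (leq_addr _ _); rewrite (cardH true) -cardV mulnC -sum_nat_const.
  by apply: leq_sum => w _; apply: (forallP full).
case/forallPn => w; rewrite -ltnNge => wdef.
pose near : {set V} := en false @: ball en H k.+1 true w.1.
(* Joining [w] to a deficient [b] outside [near] would keep degrees and girth within bounds,
   contradicting maximality. *)
have fullP b : b.1 \notin near -> D <= #|inc ven H false b|.
  apply: contraR; rewrite -ltnNge => bdef.
  have [f [fw fb]] := ven_surj w b.
  suff [h hb e] : linked en H k.+1 true f.
    apply/imsetP; exists h; first by rewrite -fw.
    by rewrite [RHS]e /en fb.
  apply/asboolP/contraT => /asboolPn nl.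
  have gf : good (f |: H).
    apply/asboolP; split; last exact: girth_add.
    move=> s u; case: (eqVneq (ven s f) u) => fu; last first.
      apply: leq_trans (deg s u); apply/subset_leq_card/subsetP => g.
      rewrite !in_inc in_setU1 => /andP[/orP[/eqP->|->]] //.
      by rewrite (negPf fu).
    apply: (@leq_trans #|f |: inc ven H s u|).
      apply/subset_leq_card/subsetP => g.
      by rewrite in_setU1 !in_inc in_setU1 => /andP[/orP[->|->]] // ->; rewrite orbT.
    apply: leq_trans (leq_card_setU _ _) _; rewrite cards1 add1n.
    by rewrite -fu; case: (s); rewrite ?fw ?fb.
  have fH : f \in H by rewrite -(Hmax _ gf (subsetUr _ _)) setU11.
  case: nl; exists f => //; apply: (subsetP (inc_ball _ _ _ _ _)).
  exact: inc_self.
have near_card : #|near| <= (D * D).+1 ^ k.+2.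
  apply: leq_trans (leq_imset_card _ _) (ltnW _).
  by apply: card_ball_lt => s v; apply: card_inc_fst.
apply: (@leq_trans (#|H| + D * (D * #|near|))); last first.
  by rewrite leq_add2l !leq_mul2l near_card !orbT.
rewrite -cardV mulnC -sum_nat_const (cardH false).
(* Only the [D] copies of each vertex of [near] can fall short, by at most [D] edges each. *)
rewrite (bigID (fun b : V * 'I_D => b.1 \in near)) /= addnC leq_add //.
  rewrite [X in _ <= X](bigID (fun b : V * 'I_D => b.1 \notin near)) /=.
  by apply: leq_trans (leq_addr _ _); apply: leq_sum => b; apply: fullP.
rewrite (eq_bigl (mem (setX near setT))) => [|b]; last by rewrite !inE andbT.
by rewrite sum_nat_const cardsX cardsT card_ord mulnC (mulnC #|near|).
Qed.

End DenseHost.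

(** * Independent sets in line graphs *)

Lemma mis_independent (V : finType) (e : rel V) S u v :
  maximal_independent_set e S -> u \in S -> v \in S -> ~~ e u v.
Proof. by move=> /maxsetP[/forall_inP ind _] /ind/forall_inP; apply. Qed.

Lemma mis_dominates (V : finType) (e : rel V) S u :
  simple_graph e -> maximal_independent_set e S -> u \notin S ->
  exists2 v, v \in S & e u v.
Proof.
move=> [sym irr] mis uS; have /maxsetP[_ maxS] := mis.
apply/exists_inP; apply: contraR uS => /exists_inPn none.
rewrite -(maxS (u |: S)) ?subsetUr ?setU11 //.
apply/forall_inP => a; rewrite in_setU1 => /orP[/eqP->|aS].
  apply/forall_inP => b; rewrite in_setU1 => /orP[/eqP->|/none//].
  by rewrite irr.
apply/forall_inP => b; rewrite in_setU1 => /orP[/eqP->|bS].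
  by rewrite sym none.
exact: mis_independent mis aS bS.
Qed.

Section LineGraph.

Variables (V E : finType) (D : nat) (ven : bool -> E -> V * 'I_D).
Variable H : {set E}.
Hypothesis deg : degree_le ven H.

Let en s f := (ven s f).1.

(** All of [E] serves as node set, so that the number of nodes is the same for every [F]; edges
    outside [F :&: H] become isolated nodes. *)
Definition line_adj (F : {set E}) : rel E := fun f g =>
  [&& f != g, f \in F :&: H, g \in F :&: H &
      (ven true f == ven true g) || (ven false f == ven false g)].

Definition line_ports (F : {set E}) (f : E) : seq E := enum (line_adj F f).

Lemma line_simple F : simple_graph (line_adj F).
Proof.
split => [f g|f]; last by rewrite /line_adj eqxx.
rewrite /line_adj eq_sym (eq_sym (ven true f)) (eq_sym (ven false f)).
by congr (_ && _); rewrite andbCA.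
Qed.

Lemma line_port_numbering F : port_numbering (line_adj F) (line_ports F).
Proof. by move=> f; split => [|g]; rewrite ?enum_uniq // mem_enum. Qed.

Lemma line_adj_shared F f g : line_adj F f g ->
  exists s, ven s f = ven s g.
Proof.
by case/and4P => _ _ _ /orP[] /eqP h; [exists true|exists false].
Qed.

Lemma line_degree F : max_degree_le (line_adj F) (D + D).
Proof.
move=> f; apply: leq_trans (leq_add (deg true (ven true f)) (deg false (ven false f))).
apply: leq_trans (leq_card_setU _ _); apply/subset_leq_card/subsetP => g.
rewrite unfold_in => /and4P[_ _]; rewrite in_setI in_setU !in_inc => /andP[_ ->].
by rewrite !(eq_sym _ (ven _ f)).
Qed.

Definition agree r s v (F F' : {set E}) :=
  F :&: ball en H r s v = F' :&: ball en H r s v.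

Lemma agree_sub r s v r' s' v' F F' :
  ball en H r' s' v' \subset ball en H r s v -> agree r s v F F' -> agree r' s' v' F F'.
Proof.
by rewrite /agree => /setIidPr <-; rewrite !setIA => ->.
Qed.

Lemma agree_mem r s v F F' g :
  agree r s v F F' -> g \in ball en H r s v -> (g \in F) = (g \in F').
Proof. by move=> /setP/(_ g); rewrite !inE => + gb; rewrite gb !andbT. Qed.

(* Every neighbour of [f] in the line graph lies one ball level closer, seen
   from one of its own ends. *)
Lemma agree_adj r s f g F F' F0 : line_adj F0 f g ->
  agree r.+1 s (en s f) F F' -> exists s', agree r s' (en s' g) F F'.
Proof.
move=> fg ag; have [s' e] := line_adj_shared fg.
have eng : en s' g = en s' f by rewrite /en e.
exists s'; rewrite eng; apply: agree_sub ag.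
have [->|/neq_negb->] := eqVneq s' s; first exact: ball_mono.
apply: ball_side.
by case/and4P: fg => _; rewrite inE => /andP[].
Qed.

Lemma line_adj_local F F' s f : f \in H -> agree 1 s (en s f) F F' ->
  line_adj F f =1 line_adj F' f.
Proof.
move=> fH ag g; rewrite /line_adj !in_setI fH.
case: (f != g) => //=; rewrite !andbT.
have fb : f \in ball en H 1 s (en s f).
  by apply: (subsetP (inc_ball _ _ _ _ _)); apply: inc_self.
rewrite (agree_mem ag fb); case: (f \in F') => //=.
have [gH|] := boolP (g \in H); last by rewrite !andbF.
rewrite !andbT; case: orP => [sh|]; last by rewrite !andbF.
have [s' e] : exists s', ven s' f = ven s' g.
  by case: sh => /eqP h; [exists true|exists false].
rewrite !andbT; apply: agree_mem ag _.
have [ss|/neq_negb ss] := eqVneq s' s.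
  by apply: (subsetP (inc_ball _ _ _ _ _)); rewrite in_inc gH /en -ss e eqxx.
by apply: (subsetP (ball_side _ _ _ fH)); rewrite in_inc gH -ss /en e eqxx.
Qed.

Variables (A : local_algorithm) (Delta : nat) (ident : E -> nat).

Definition line_state F t f :=
  state_after A Delta (line_adj F) (line_ports F) ident t f.

(** The initial state already depends on the degree, hence on the edges at both ends of [f], whence
    the extra level; each round costs one more by [agree_adj]. *)
Lemma line_state_local F F' t s f : f \in H ->
  agree t.+1 s (en s f) F F' -> line_state F t f = line_state F' t f.
Proof.
elim: t s f => [|t IH] s f fH ag.
  rewrite /line_state /= /degree; congr init.
  exact/eq_card/(line_adj_local fH ag).
have ag' := agree_sub (ball_mono _ _ _ _ _) ag.
have adjE : line_adj F f =1 line_adj F' f.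
  by apply: (@line_adj_local _ _ s f fH); apply: agree_sub ag; apply: ball_mono_le.
rewrite /line_state /= -!/(line_state _ _ _) (IH s f) //; congr receive.
rewrite /line_ports (eq_enum adjE); apply/eq_in_map => g; rewrite mem_enum => fg.
have gH : g \in H by move: fg; rewrite unfold_in => /and4P[_ _]; rewrite inE => /andP[].
have [s' agg] := agree_adj fg ag.
rewrite -!/(line_state _ _ _) (IH s' g) // /port_of /line_ports.
rewrite (@eq_enum _ (line_adj F g) (line_adj F' g)) //.
apply: (@line_adj_local _ _ s' g gH); apply: agree_sub agg.
exact: ball_mono_le.
Qed.

Variable T : nat.

Definition line_output F : {set E} :=
  output_set A Delta (line_adj F) (line_ports F) ident T.

Definition initial_label F f : label :=
  if f \in line_output F then Matched
  else if [exists g in F :&: inc en H true (en true f), g \in line_output F]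
  then Other else Pointer.

Hypothesis mis : forall F, maximal_independent_set (line_adj F) (line_output F).

(** Output edges at an unsplit node use different copies, since two at the same copy would be
    adjacent in the line graph. This gives the initial slack [D]. *)
Lemma card_matched F s v :
  #|[set f in F :&: inc en H s v | f \in line_output F]| <= D.
Proof.
rewrite -[X in _ <= X]card_ord.
rewrite -(@card_in_imset _ _ (fun f => (ven s f).2)) ?max_card //.
move=> f g /setIdP[/setIP[fF +] fo] /setIdP[/setIP[gF +] go] e.
rewrite !in_inc => /andP[fH /eqP fv] /andP[gH /eqP gv]; apply/eqP/contraT => ne.
have ev : ven s f = ven s g.
  by apply: injective_projections => //; rewrite -/(en s f) -/(en s g) fv gv.
have := mis_independent (mis F) fo go.
rewrite /line_adj ne !inE fF fH gF gH /=.
by case: (s) ev => ->; rewrite eqxx ?orbT.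
Qed.

Lemma initial_matched F f : (initial_label F f == Matched) = (f \in line_output F).
Proof. by rewrite /initial_label; case: ifP => // _; case: ifP. Qed.

Lemma initial_wild F f : (initial_label F f == Wild) = false.
Proof. by rewrite /initial_label; case: ifP => // _; case: ifP. Qed.

Lemma initial_local F F' f : f \in H -> agree T.+1 true (en true f) F F' ->
  initial_label F f = initial_label F' f.
Proof.
move=> fH ag; have outE g : g \in inc en H true (en true f) ->
    (g \in line_output F) = (g \in line_output F').
  rewrite in_inc => /andP[gH /eqP ge].
  have := @line_state_local F F' T true g gH; rewrite ge => /(_ ag).
  by rewrite !inE /line_state => ->.
rewrite /initial_label outE ?inc_self //.
set b := [exists g in _, _].
suff -> : b = [exists g in F' :&: inc en H true (en true f), g \in line_output F'] by [].
apply: eq_existsb => g; rewrite !in_setI.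
case gi: (g \in inc _ _ _ _); rewrite ?andbF //=.
rewrite outE // (agree_mem ag) //.
exact: (subsetP (inc_ball _ _ _ _ _)).
Qed.

Lemma initial_active F v : active 0 D (initial_label F) (F :&: inc en H true v).
Proof.
have eqs : [set f in F :&: inc en H true v | initial_label F f \in [:: Matched; Wild]]
    = [set f in F :&: inc en H true v | f \in line_output F].
  apply: eq_finset => f.
  by rewrite 2!in_cons in_nil initial_matched initial_wild !orbF.
have [/exists_inP[m mA mo]|none] :=
    boolP [exists g in F :&: inc en H true v, g \in line_output F].
  left; split; last by rewrite eqs card_matched.
    by exists m => //; apply/eqP; rewrite initial_matched.
  move=> f fA; rewrite /initial_label; case: ifP => // _.
  have -> : en true f = v by move: fA; rewrite !inE => /and3P[_ _ /eqP].
  by rewrite (introT exists_inP) //; exists m.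
right; split => [f fA|].
  rewrite /initial_label; case: ifP => [fo|_].
    by case/exists_inP: none; exists f.
  have -> : en true f = v by move: fA; rewrite !inE => /and3P[_ _ /eqP].
  by rewrite (negPf none).
rewrite leqn0 cards_eq0; apply/eqP/setP => f; rewrite !inE.
by rewrite initial_wild andbF.
Qed.

(** If [u] has no output edge, maximality gives each edge [f] at [u] an output neighbour, which must
    meet it at the active end, so [f] is labelled [Other]. *)
Lemma initial_passive F u : passive 0 D (initial_label F) (F :&: inc en H false u).
Proof.
have [/exists_inP[m mA mo]|/exists_inPn none] :=
    boolP [exists g in F :&: inc en H false u, g \in line_output F].
  left; split; last by exists m => //; rewrite inE initial_matched mo.
  rewrite (_ : [set _ in _ | _] =
               [set f in F :&: inc en H false u | f \in line_output F]).
    exact: card_matched.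
  by apply: eq_finset => f; rewrite initial_matched.
right; rewrite leqn0 cards_eq0; apply/eqP/setP => f; rewrite inE [RHS]inE.
apply/negP => /andP[fA]; have fo := none f fA.
suff /exists_inP ex : exists2 g, g \in F :&: inc en H true (en true f) &
    g \in line_output F by rewrite /initial_label (negPf fo) ex.
have [g go fg] := mis_dominates (line_simple F) (mis F) fo.
have gFH : g \in F :&: H by case/and4P: fg.
case/and4P: fg => _ _ _ /orP[] /eqP e; exists g => //.
  by rewrite in_setI in_inc andbA -in_setI gFH /en e eqxx.
have /none/negP : g \in F :&: inc en H false u; last by [].
rewrite in_setI in_inc andbA -in_setI gFH /en -e.
by move: fA; rewrite !inE => /and3P[].
Qed.

Lemma initial_solves : solves en H true T.+1 0 D initial_label.
Proof.
split; [exact: initial_local | exact: initial_active | exact: initial_passive].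
Qed.

End LineGraph.

(** * Choice of parameters *)

Lemma girth_gt_leq (V E : finType) (en : bool -> E -> V) H k k' :
  k' <= k -> girth_gt en H k -> girth_gt en H k'.
Proof.
move=> le gt x p pp /andP[p0 pk]; apply: (gt x p pp).
by rewrite p0 (leq_trans pk).
Qed.

Lemma no_fast_mis (A : local_algorithm) (T n Delta C : nat)
    (D := 10 * T.+1) (N := 2 * (D * D).+1 ^ (T + T + 7)) :
  0 < C -> D + D <= Delta -> (N * D) ^ 2 <= n ->
  ~ finds_mis_in A T n Delta C.
Proof.
move=> C0 DDelta NDn mis.
have D0 : 0 < D by rewrite /D.
have N0 : 0 < N by rewrite /N muln_gt0 expn_gt0.
pose W : finType := ('I_N * 'I_D)%type.
have cardW : #|W| = N * D by rewrite card_prod !card_ord.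
(* One edge for each pair of split nodes, padded to exactly [n] by dummy edges that all join the two
   nodes [w0], one on each side. *)
pose E : finType := ((W * W) + 'I_(n - (N * D) ^ 2))%type.
have cardE : #|E| = n.
  by rewrite card_sum card_prod !cardW card_ord -mulnn subnKC // mulnn.
pose w0 : W := (Ordinal N0, Ordinal D0).
pose ven (s : bool) (f : E) : 'I_N * 'I_D :=
  match f with inl wb => if s then wb.1 else wb.2 | inr _ => w0 end.
have surj w b : exists f, ven true f = w /\ ven false f = b.
  by exists (inl (w, b)).
have [H [deg gt dense]] := @dense_host 'I_N E D (T + T + 5) ven surj.
(* A single assignment with values 1 to [n] serves all inputs, since the elimination varies only
   [F]. *)
pose ident (f : E) : nat := (enum_rank f).+1.
have ids : id_assignment (n ^ C) ident.
  split => [f g [/ord_inj/enum_rank_inj]|f] //.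
  rewrite /ident /=; apply: leq_trans (ltn_ord _) _.
  rewrite [X in X <= _]cardE -{1}[n]expn1 leq_pexp2l // -{1}cardE.
  by apply/card_gt0P; exists f.
have sol : solves (fun s f => (ven s f).1) H true T.+1 0 D _ :=
  initial_solves (fun F => mis E (line_adj ven H F) (line_ports ven H F) ident
    cardE (line_simple ven H F)
    (fun f => leq_trans (line_degree deg F f) DDelta)
    (line_port_numbering ven H F) ids).
have disj i : i < T.+1 -> branches_disjoint (fun s f => (ven s f).1) H i.
  move=> iT; apply: girth_branches_disjoint; apply: girth_gt_leq gt; lia.
have [s' [x [out [lex solx]]]] := iterate_step disj sol.
have inj v : {in inc (fun s f => (ven s f).1) H (~~ s') v &,
                 injective (fun f => (ven s' f).1)}.
  by apply: (@girth_inc_inj _ _ (fun s f => (ven s f).1)); apply: girth_gt_leq gt; lia.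
have := zero_round_card inj solx.
move: dense; rewrite card_ord -[(T + T + 5).+2]addn2 -addnA -/N.
(* The factor 2 in [N] keeps the loss term of [dense] at half of its left side. *)
have [M M0 NM] : exists2 M, 0 < M & N = M + M.
  by exists ((D * D).+1 ^ (T + T + 7)); rewrite ?expn_gt0 // /N mul2n -addnn.
have -> : (D * D).+1 ^ (T + T + 7) = M by move: NM; rewrite /N; lia.
rewrite NM => dense sparse.
have : M * (D * D) <= M * (2 * (D + T.+1 + 3 * x)) by nia.
(* With [r = T.+1], [D = 10 r] and [x <= 11 r^2] this yields [100 r^2 <= 22 r + 66 r^2], impossible
   for positive [r]. *)
rewrite leq_pmul2l //; move: lex; rewrite /D; nia.
Qed.

Lemma no_fast_mis_pow (A : local_algorithm) (T n Delta C : nat) :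
  0 < C -> 20 * T.+1 <= Delta -> (20 * T.+1) ^ (30 * T.+1) <= n ->
  ~ finds_mis_in A T n Delta C.
Proof.
move=> C0 hD hn; apply: no_fast_mis => //; first by lia.
set r := T.+1 in hD hn *; set b := 20 * r in hD hn *.
have b0 : 0 < b by rewrite /b /r; lia.
have lb : (10 * r * (10 * r)).+1 <= b ^ 2 by rewrite /b -mulnn /r; nia.
have -> : 2 * (10 * r * (10 * r)).+1 ^ (T + T + 7) * (10 * r) =
    b * (10 * r * (10 * r)).+1 ^ (T + T + 7) by rewrite /b; lia.
apply: leq_trans hn; apply: (@leq_trans ((b * (b ^ 2) ^ (T + T + 7)) ^ 2)).
  by rewrite leq_sqr leq_mul2l leq_exp2r ?lb ?orbT //; lia.
(* The exponent is 2 (1 + 2 (2 T + 7)) = 8 T + 30, at most [30 * r]. *)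
by rewrite -expnM -expnS -expnM leq_pexp2l // /r; lia.
Qed.

Local Open Scope ring_scope.

(** Follows from [ln y <= y] at the square root of [L]; it serves to make [L / log2 L] at least
    100. *)
Lemma log2_sublinear (R : realType) (L : R) :
  0 < L -> (200 / ln 2) ^+ 2 <= L -> 100 * log2 L <= L.
Proof.
move=> L0 hL; have l2 : 0 < ln 2 :> R by rewrite ln_gt0 // ltr1n.
have s0 : 0 < Num.sqrt L by rewrite sqrtr_gt0.
have sL : 200 / ln 2 <= Num.sqrt L.
  rewrite -(@ler_pXn2r _ 2%N) ?nnegrE ?(ltW s0) ?divr_ge0 ?(ltW l2) //.
  by rewrite sqr_sqrtr // ltW.
have lnL : ln L <= 2 * Num.sqrt L.
  rewrite -{1}(sqr_sqrtr (ltW L0)) lnXn // mulr2n.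
  by have := ln_sublinear s0; lra.
rewrite /log2 mulrA ler_pdivrMr //.
rewrite ler_pdivrMr // in sL.
have -> : L * ln 2 = Num.sqrt L * (Num.sqrt L * ln 2).
  by rewrite mulrA -expr2 sqr_sqrtr // ltW.
apply: (@le_trans _ _ (Num.sqrt L * 200)); first by lra.
by rewrite ler_pM2l.
Qed.

Theorem corollary4p17 (R : realType) :
  exists C0 : nat, forall C : nat, (C0 <= C)%N ->
  exists (c : R) (n0 Delta0 : nat), 0 < c /\
    forall n Delta : nat, (n0 <= n)%N -> (Delta0 <= Delta)%N ->
    forall (A : local_algorithm) (T : nat),
      T%:R < c * Num.min Delta%:R (log2 n%:R / log2 (log2 n%:R)) ->
      ~ finds_mis_in A T n Delta C.
Proof.
have l2 : 0 < ln 2 :> R by rewrite ln_gt0 // ltr1n.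
(* [C0 = 1] suffices since the identifiers used are 1 to [n]. The choice of [m] makes
   [log2_sublinear] applicable to [L] and gives [2 <= L]. *)
exists 1%N => C C1.
pose m := (Num.truncn ((200 / ln 2) ^+ 2 : R)).+3.
exists 100%:R^-1, (2 ^ m)%N, 40%N; split => [|n Delta hn hDelta A T].
  by rewrite invr_gt0 ltr0n.
set L := log2 n%:R; set l := log2 L => hT.
have n0 : (0 < n)%N by rewrite (leq_trans _ hn) // expn_gt0.
have n0R : 0 < n%:R :> R by rewrite ltr0n.
have mL : m%:R <= L.
  rewrite /L /log2 ler_pdivlMr // mulr_natl -lnXn // -natrX.
  by rewrite ler_ln ?posrE ?ler_nat // ltr0n expn_gt0.
have aL : (200 / ln 2) ^+ 2 <= L.
  apply: le_trans mL; apply: ltW; apply: lt_le_trans (truncnS_gt _) _.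
  by rewrite ler_nat; apply: ltnW.
have L2 : 2 <= L by apply: le_trans mL; rewrite ler_nat.
have L0 : 0 < L by lra.
have lL : 100 * l <= L := log2_sublinear L0 aL.
have l1 : 1 <= l.
  by rewrite /l /log2 ler_pdivlMr // mul1r ler_ln // posrE // ltr0n.
have l0 : 0 < l by lra.
have hT1 : T%:R < 100^-1 * Delta%:R :> R.
  by apply: lt_le_trans hT _; rewrite ler_pM2l ?invr_gt0 ?ltr0n // ge_min lexx.
have hT2 : T%:R < 100^-1 * (L / l).
  by apply: lt_le_trans hT _; rewrite ler_pM2l ?invr_gt0 ?ltr0n // ge_min lexx orbT.
have hL : 100 <= L / l by rewrite ler_pdivlMr.
(* The bound [100 <= L / l] absorbs the successor by doubling 1/100 to 1/50. *)
have rL : T.+1%:R <= 50^-1 * (L / l) by rewrite -natr1; lra.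
have LlL : L / l <= L by rewrite ler_pdivrMr // ler_peMr // ltW.
apply: no_fast_mis_pow => //.
  have hD : 40 <= Delta%:R :> R by rewrite ler_nat.
  by rewrite -(ler_nat R) natrM -natr1; lra.
have bL : (20 * T.+1)%:R <= L by rewrite natrM; lra.
(* In logarithms, with [r = T.+1]: [30 r ln (20 r) <= (30 / 50) (L / l) (l ln 2)], which is below
   [ln n = L ln 2]. *)
rewrite -(ler_nat R) -ler_ln ?posrE ?ltr0n ?expn_gt0 //.
rewrite natrX lnXn ?ltr0n // -[X in X <= _]mulr_natl [(30 * _)%:R]natrM.
have lnb : ln (20 * T.+1)%:R <= l * ln 2 :> R.
  by rewrite /l /log2 divfK ?gt_eqF // ler_ln ?posrE ?ltr0n.
have lnn : ln n%:R = L * ln 2 by rewrite /L /log2 divfK ?gt_eqF.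
rewrite lnn; apply: (@le_trans _ _ (30 * (50^-1 * (L / l)) * (l * ln 2))).
  apply: ler_pM => //; last by rewrite ler_pM2l ?ltr0n.
    by rewrite mulr_ge0 ?ler0n.
  by rewrite ln_ge0 // ler1n.
have -> : 30 * (50^-1 * (L / l)) * (l * ln 2) = 30 / 50 * (L * ln 2).
  by field; rewrite gt_eqF.
have : 0 < L * ln 2 by rewrite mulr_gt0.
lra.
Qed.
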